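(* Let $(H,\chi)$, $\chi=[-,-,-]$, be a Hopf heap with underlying coalgebra $(H,\Delta,\varepsilon)$, and let $(H,\circ,\Delta,\varepsilon)$ be a nonunital bialgebra. Then $H$ is a Hopf truss if and only if $$a\circ[b,c,d]=[a_1\circ b,\ a_2\circ c,\ a_3\circ d]\qquad\text{for any }a,b,c,d\in H.$$
   Context: Everything is over a fixed field $\mathbf{k}$. Sweedler notation $\Delta(c)=c_1\otimes c_2$ is used; $C^{cop}$ is the co-opposite coalgebra of a coalgebra $C$; the set $G(C)$ of group-like elements of a coalgebra $C$ is always assumed non-empty. A Hopf heap is a coalgebra $C$ with a coalgebra map $\chi:C\otimes C^{cop}\otimes C\to C$, $a\otimes b\otimes c\mapsto[a,b,c]$, such that $[[a,b,c],d,h]=[a,b,[c,d,h]]$ and $[c_1,c_2,a]=[a,c_1,c_2]=\varepsilon(c)a$ for all $a,b,c,d,h\in C$. Every Hopf algebra with antipode $S$ is a Hopf heap with $[a,b,c]=aS(b)c$; conversely, if $C$ is a Hopf heap and $x\in G(C)$, the coalgebra $C$ becomes a Hopf algebra with unit $x$, multiplication $ab=[a,x,b]$ and antipode $S(a)=[x,a,x]$. A nonunital bialgebra $(H,\circ,\Delta,\varepsilon)$ is a coalgebra with an associative (not necessarily unital) multiplication $\circ$ that is a coalgebra map $H\otimes H\to H$. A coalgebra $(H,\Delta,\varepsilon)$ with two binary operations $\cdot$ and $\circ$ such that $(H,\cdot,\Delta,\varepsilon)$ is a Hopf algebra (with unit $1$ and antipode $S$) and $(H,\circ,\Delta,\varepsilon)$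 is a nonunital bialgebra is a (left) Hopf truss if there exists a coalgebra endomorphism $\sigma$ of $(H,\Delta,\varepsilon)$ such that $a\circ(bc)=(a_1\circ b)S(\sigma(a_2))(a_3\circ c)$ for all $a,b,c\in H$. *)

(* Defs.v *)
From HB Require Import structures.
From mathcomp Require Import all_boot all_algebra.
From mathcomp Require Import generic_quotient boolp.

Set Implicit Arguments.
Unset Strict Implicit.
Unset Printing Implicit Defensive.

Import GRing.Theory.
Local Open Scope ring_scope.
Local Open Scope quotient_scope.

Reserved Notation "U *T V" (at level 40, left associativity).
Reserved Notation "u *t v" (at level 40, left associativity).

(* Tensor product of (possibly infinite-dimensional) vector spaces: the list
   [:: (u1, v1); ...; (un, vn)] stands for the formal sum of the ui (x) vi, and
   tensor_eq is the congruence generated by the defining relations of the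
   tensor product. *)
Section Tensor.
Context {k : fieldType} (U V : lmodType k).
Implicit Types (s t : seq (U * V)) (u : U) (v : V).

Inductive tensor_eq : seq (U * V) -> seq (U * V) -> Prop :=
| tensor_eq_refl s : tensor_eq s s
| tensor_eq_sym s t : tensor_eq s t -> tensor_eq t s
| tensor_eq_trans s t r : tensor_eq s t -> tensor_eq t r -> tensor_eq s r
| tensor_eq_cat s s' t t' :
    tensor_eq s s' -> tensor_eq t t' -> tensor_eq (s ++ t) (s' ++ t')
| tensor_eq_catC s t : tensor_eq (s ++ t) (t ++ s)
| tensor_eqDl u u' v : tensor_eq [:: (u + u', v)] [:: (u, v); (u', v)]
| tensor_eqDr u v v' : tensor_eq [:: (u, v + v')] [:: (u, v); (u, v')]
| tensor_eqZ a u v : tensor_eq [:: (a *: u, v)] [:: (u, a *: v)]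
| tensor_eq0 v : tensor_eq [:: (0, v)] [::].

Definition tensor_eqb s t := `[< tensor_eq s t >].

Lemma tensor_eqb_refl : reflexive tensor_eqb.
Proof. by move=> s; apply/asboolP; constructor. Qed.

Lemma tensor_eqb_sym : symmetric tensor_eqb.
Proof. by move=> s t; apply/asboolP/asboolP; apply: tensor_eq_sym. Qed.

Lemma tensor_eqb_trans : transitive tensor_eqb.
Proof.
move=> t s r /asboolP st /asboolP tr; apply/asboolP.
exact: tensor_eq_trans tr.
Qed.

Canonical tensor_equiv :=
  EquivRel tensor_eqb tensor_eqb_refl tensor_eqb_sym tensor_eqb_trans.

Definition tensor : Type := {eq_quot tensor_equiv}.
HB.instance Definition _ := Choice.on tensor.
HB.instance Definition _ : EqQuotient _ tensor_equiv tensor := EqQuotient.on tensor.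

Lemma tensor_piP s t :
  reflect (\pi_tensor s = \pi_tensor t) (tensor_eqb s t).
Proof. exact: (iffP (@eqmodP _ tensor_equiv s t)). Qed.

Lemma tensor_pi_eq s t : tensor_eq s t -> \pi_tensor s = \pi_tensor t.
Proof. by move=> st; apply/tensor_piP/asboolP. Qed.

Lemma tensor_repr_eq s : tensor_eq (repr (\pi_tensor s)) s.
Proof. by apply/asboolP/tensor_piP; rewrite reprK. Qed.

Definition seq_scale (a : k) s := [seq (a *: p.1, p.2) | p <- s].

Lemma seq_scale_eq a s t :
  tensor_eq s t -> tensor_eq (seq_scale a s) (seq_scale a t).
Proof.
rewrite /seq_scale; elim=> {s t} /=.
- by move=> s; constructor.
- by move=> s t _; apply: tensor_eq_sym.
- by move=> s t r _ + _; apply: tensor_eq_trans.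
- by move=> s s' t t' _ ss' _ tt'; rewrite !map_cat; apply: tensor_eq_cat.
- by move=> s t; rewrite !map_cat; apply: tensor_eq_catC.
- by move=> u u' v; rewrite scalerDr; apply: tensor_eqDl.
- by move=> u v v'; apply: tensor_eqDr.
- by move=> b u v; rewrite scalerA mulrC -scalerA; apply: tensor_eqZ.
- by move=> v; rewrite scaler0; apply: tensor_eq0.
Qed.

Definition tensor_zero : tensor := \pi_tensor [::].
Definition tensor_add (x y : tensor) : tensor := \pi_tensor (repr x ++ repr y).
Definition tensor_scale a (x : tensor) : tensor := \pi_tensor (seq_scale a (repr x)).
Definition tensor_opp (x : tensor) : tensor := tensor_scale (-1) x.

Lemma tensor_add_pi s t :
  tensor_add (\pi_tensor s) (\pi_tensor t) = \pi_tensor (s ++ t).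
Proof. by apply/tensor_pi_eq/tensor_eq_cat; apply: tensor_repr_eq. Qed.

Lemma tensor_scale_pi a s :
  tensor_scale a (\pi_tensor s) = \pi_tensor (seq_scale a s).
Proof. by apply/tensor_pi_eq/seq_scale_eq/tensor_repr_eq. Qed.

Lemma tensor_piW (P : tensor -> Prop) :
  (forall s, P (\pi_tensor s)) -> forall x, P x.
Proof. by move=> Ps x; rewrite -[x]reprK. Qed.

Lemma tensor_addA : associative tensor_add.
Proof.
elim/tensor_piW=> s; elim/tensor_piW=> t; elim/tensor_piW=> r.
by rewrite !tensor_add_pi catA.
Qed.

Lemma tensor_addC : commutative tensor_add.
Proof.
elim/tensor_piW=> s; elim/tensor_piW=> t; rewrite !tensor_add_pi.
exact/tensor_pi_eq/tensor_eq_catC.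
Qed.

Lemma tensor_add0 : left_id tensor_zero tensor_add.
Proof. by elim/tensor_piW=> s; rewrite tensor_add_pi. Qed.

Lemma tensor_scaleDl x :
  {morph tensor_scale^~ x : a b / a + b >-> tensor_add a b}.
Proof.
elim/tensor_piW: x => s a b; rewrite !tensor_scale_pi tensor_add_pi.
apply: tensor_pi_eq; elim: s => [|[u v] s IHs] /=; first by constructor.
rewrite scalerDl -cat1s.
apply: tensor_eq_trans (tensor_eq_cat (tensor_eqDl _ _ _) IHs) _ => /=.
rewrite -[X in tensor_eq X _]cat1s -[X in tensor_eq _ X]cat1s.
apply: tensor_eq_cat; first by constructor.
rewrite -cat1s catA -[(_, v) :: _ in X in tensor_eq _ X]cat1s catA.
by apply: tensor_eq_cat; [apply: tensor_eq_catC | constructor].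
Qed.

Lemma tensor_scale0 x : tensor_scale 0 x = tensor_zero.
Proof.
elim/tensor_piW: x => s; rewrite tensor_scale_pi.
apply: tensor_pi_eq; elim: s => [|[u v] s IHs] /=; first by constructor.
by rewrite scale0r -cat1s; apply: (tensor_eq_cat (tensor_eq0 v) IHs).
Qed.

Lemma tensor_scale1 : left_id 1 tensor_scale.
Proof.
elim/tensor_piW=> s; rewrite tensor_scale_pi; congr (\pi_tensor _).
by rewrite -[RHS]map_id; apply: eq_map => -[u v]; rewrite /= scale1r.
Qed.

Lemma tensor_addN : left_inverse tensor_zero tensor_opp tensor_add.
Proof.
move=> x; rewrite -[X in tensor_add _ X]tensor_scale1.
by rewrite -tensor_scaleDl addNr tensor_scale0.
Qed.

HB.instance Definition _ :=
  GRing.isZmodule.Build tensor tensor_addA tensor_addC tensor_add0 tensor_addN.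

Lemma tensor_piD s t : \pi_tensor s + \pi_tensor t = \pi_tensor (s ++ t).
Proof. exact: tensor_add_pi. Qed.

Lemma tensor_scaleA a b x :
  tensor_scale a (tensor_scale b x) = tensor_scale (a * b) x.
Proof.
elim/tensor_piW: x => s; rewrite !tensor_scale_pi; congr (\pi_tensor _).
by rewrite /seq_scale -map_comp; apply: eq_map => p; rewrite /= scalerA.
Qed.

Lemma tensor_scaleDr : right_distributive tensor_scale +%R.
Proof.
move=> a; elim/tensor_piW=> s; elim/tensor_piW=> t.
by rewrite tensor_piD !tensor_scale_pi tensor_piD /seq_scale map_cat.
Qed.

HB.instance Definition _ := GRing.Zmodule_isLmodule.Build k tensor
  tensor_scaleA tensor_scale1 tensor_scaleDr tensor_scaleDl.

Lemma tensor_piZ a s : a *: \pi_tensor s = \pi_tensor (seq_scale a s).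
Proof. exact: tensor_scale_pi. Qed.

Definition tpure u v : tensor := \pi_tensor [:: (u, v)].

Lemma tpure_bilinear : bilinear_for *:%R *:%R tpure.
Proof.
split=> [v a u u'|u a v v']; rewrite /tpure /= ?tensor_piZ ?tensor_piD.
  exact/tensor_pi_eq/tensor_eqDl.
apply/tensor_pi_eq/(tensor_eq_trans (tensor_eqDr _ _ _)).
apply: (@tensor_eq_cat [:: _] [:: _] [:: _] [:: _]); last by constructor.
exact/tensor_eq_sym/tensor_eqZ.
Qed.

HB.instance Definition _ :=
  bilinear_isBilinear.Build k U V tensor *:%R *:%R tpure tpure_bilinear.

Lemma tensorE (x : tensor) : x = \sum_(p <- repr x) tpure p.1 p.2.
Proof.
rewrite -[LHS]reprK; elim: (repr x) => [|[u v] s IHs]; first by rewrite big_nil.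
by rewrite big_cons -IHs tensor_piD.
Qed.

(* The linear map out of the tensor product induced by f. It is only
   meaningful for bilinear f, in which case it does not depend on the chosen
   decomposition of x into pure tensors (tlift_eq below). *)
Definition tlift (W : lmodType k) (f : U -> V -> W) (x : tensor) : W :=
  \sum_(p <- repr x) f p.1 p.2.

Section Lift.
Variables (W : lmodType k) (f : U -> V -> W).
Hypothesis fB : bilinear_for *:%R *:%R f.

Lemma tensor_eq_sum s t : tensor_eq s t ->
  \sum_(p <- s) f p.1 p.2 = \sum_(p <- t) f p.1 p.2.
Proof.
have [fl fr] := fB.
have fDl u u' v : f (u + u') v = f u v + f u' v.
  by have /= := fl v 1 u u'; rewrite !scale1r.
have fDr u v v' : f u (v + v') = f u v + f u v'.
  by have /= := fr u 1 v v'; rewrite !scale1r.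
have f0l v : f 0 v = 0 by apply: (addrI (f 0 v)); rewrite -fDl !addr0.
have f0r u : f u 0 = 0 by apply: (addrI (f u 0)); rewrite -fDr !addr0.
elim=> {s t} /=.
- by [].
- by move=> s t _ ->.
- by move=> s t r _ -> _ ->.
- by move=> s s' t t' _ ss' _ tt'; rewrite !big_cat /= ss' tt'.
- by move=> s t; rewrite !big_cat /= addrC.
- by move=> u u' v; rewrite !big_cons !big_nil /= !addr0 fDl.
- by move=> u v v'; rewrite !big_cons !big_nil /= !addr0 fDr.
- move=> a u v; rewrite !big_cons !big_nil /= !addr0.
  have /= := fl v a u 0; have /= := fr u a v 0.
  by rewrite !addr0 f0l f0r !addr0 => -> ->.
- by move=> v; rewrite big_cons big_nil /= addr0 f0l.
Qed.

Lemma tlift_pi s : tlift f (\pi_tensor s) = \sum_(p <- s) f p.1 p.2.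
Proof. exact/tensor_eq_sum/tensor_repr_eq. Qed.

Lemma tlift_linear : linear (tlift f).
Proof.
move=> a; elim/tensor_piW=> s; elim/tensor_piW=> t.
rewrite tensor_piZ tensor_piD !tlift_pi.
rewrite big_cat big_map scaler_sumr; congr (_ + _); apply: eq_bigr => p _ /=.
have f0 : f 0 p.2 = 0.
  by apply: (addrI (f 0 p.2)); have /= := fB.1 p.2 1 0 0; rewrite !scale1r !addr0.
by have /= := fB.1 p.2 a p.1 0; rewrite f0 !addr0.
Qed.

Lemma tlift_pure u v : tlift f (tpure u v) = f u v.
Proof. by rewrite tlift_pi big_seq1. Qed.

Lemma tlift_eq (s : seq (U * V)) (x : tensor) :
  x = \sum_(p <- s) tpure p.1 p.2 -> tlift f x = \sum_(p <- s) f p.1 p.2.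
Proof.
move=> ->.
pose L := GRing.isLinear.Build k tensor W *:%R (tlift f) tlift_linear.
pose F : {linear tensor -> W} := HB.pack (tlift f) L.
rewrite -[LHS]/(F _) linear_sum; apply: eq_bigr => p _; exact: tlift_pure.
Qed.

End Lift.

Lemma tensor_lin_ext (W : lmodType k) (f g : tensor -> W) :
  linear f -> linear g -> (forall u v, f (tpure u v) = g (tpure u v)) ->
  f =1 g.
Proof.
move=> fL gL fg x.
pose F : {linear tensor -> W} :=
  HB.pack f (GRing.isLinear.Build k tensor W *:%R f fL).
pose G : {linear tensor -> W} :=
  HB.pack g (GRing.isLinear.Build k tensor W *:%R g gL).
rewrite -[f x]/(F x) -[g x]/(G x) (tensorE x) !linear_sum.
by apply: eq_bigr => p _; apply: fg.
Qed.

End Tensor.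

(* As an lmodType rather than a Type, so that nested products elaborate without
   reverse coercions. *)
Notation "U *T V" := (Defs_tensor__canonical__GRing_Lmodule U V) : type_scope.
Notation "u *t v" := (tpure u v) : ring_scope.

Lemma tlift_linear_param (k : fieldType) (U V W X : lmodType k)
    (f : W -> U -> V -> X) (x : U *T V) :
  (forall u v, linear (fun w => f w u v)) ->
  linear (fun w => tlift (f w) x).
Proof.
move=> fL a w w'; rewrite scaler_sumr -big_split; apply: eq_bigr => p _.
exact: (fL p.1 p.2).
Qed.

Lemma linear_compP (k : fieldType) (U V W : lmodType k) (f : V -> W)
    (g : U -> V) : linear f -> linear g -> linear (f \o g).
Proof. by move=> fL gL a x y /=; rewrite gL fL. Qed.

Lemma tpure_linearl (k : fieldType) (U V : lmodType k) (v : V) :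
  linear (fun u : U => u *t v).
Proof. exact: (tpure_bilinear U V).1. Qed.

Lemma tpure_linearr (k : fieldType) (U V : lmodType k) (u : U) :
  linear (fun v : V => u *t v).
Proof. exact: (tpure_bilinear U V).2. Qed.

Lemma tensor_ext (k : fieldType) (U V W : lmodType k)
    (f g : {linear U *T V -> W}) :
  (forall u v, f (u *t v) = g (u *t v)) -> f =1 g.
Proof. by move=> fg x; rewrite (tensorE x) !linear_sum; apply: eq_bigr. Qed.

Lemma tensor_ext2 (k : fieldType) (U V U' V' W : lmodType k)
    (f g : {linear (U *T V) *T (U' *T V') -> W}) :
  (forall u v u' v', f ((u *t v) *t (u' *t v')) = g ((u *t v) *t (u' *t v'))) ->
  f =1 g.
Proof.
move=> fg; apply: tensor_ext => x y; rewrite (tensorE x) (tensorE y).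
rewrite !linear_sumlz !linear_sum; apply: eq_bigr => p _.
by rewrite !linear_sum; apply: eq_bigr => q _; apply: fg.
Qed.

Lemma tensor_ext3 (k : fieldType) (U V W U' V' W' X : lmodType k)
    (f g : {linear ((U *T V) *T W) *T ((U' *T V') *T W') -> X}) :
  (forall u v w u' v' w',
     f (((u *t v) *t w) *t ((u' *t v') *t w')) =
     g (((u *t v) *t w) *t ((u' *t v') *t w'))) -> f =1 g.
Proof.
move=> fg; apply: tensor_ext2 => x w y w'; move: x.
have L (h : {linear ((U *T V) *T W) *T ((U' *T V') *T W') -> X}) z :
    linear (fun x => h ((x *t w) *t z)).
  by move=> a x x'; rewrite !tpure_linearl linearP.
have R (h : {linear ((U *T V) *T W) *T ((U' *T V') *T W') -> X}) z :
    linear (fun y => h (z *t (y *t w'))).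
  by move=> a x x'; rewrite tpure_linearl tpure_linearr linearP.
apply: (tensor_lin_ext (L f _) (L g _)) => u v; move: y.
by apply: (tensor_lin_ext (R f _) (R g _)) => u' v'; apply: fg.
Qed.

Section TensorMaps.
Context {k : fieldType}.

Section Map.
Variables (U U' V V' : lmodType k).

Definition tmap (f : U -> U') (g : V -> V') : U *T V -> U' *T V' :=
  tlift (fun u v => f u *t g v).

Variables (f : {linear U -> U'}) (g : {linear V -> V'}).

Let tmap_bilinear : bilinear_for *:%R *:%R (fun u v => f u *t g v).
Proof.
by split=> [v|u] a x y; rewrite linearP ?(tpure_linearl, tpure_linearr).
Qed.

Lemma tmap_linear : linear (tmap f g).
Proof. exact: tlift_linear tmap_bilinear. Qed.
HB.instance Definition _ :=
  GRing.isLinear.Build k _ _ *:%R (tmap f g) tmap_linear.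

Lemma tmapE u v : tmap f g (u *t v) = f u *t g v.
Proof. exact: tlift_pure. Qed.
End Map.

Section Swap.
Variables (U V : lmodType k).

Definition tswap : U *T V -> V *T U := tlift (fun u v => v *t u).

Let tswap_bilinear : bilinear_for *:%R *:%R (fun (u : U) (v : V) => v *t u).
Proof. by split=> ?; [apply: tpure_linearr | apply: tpure_linearl]. Qed.

Lemma tswap_linear : linear tswap.
Proof. exact: tlift_linear tswap_bilinear. Qed.
HB.instance Definition _ := GRing.isLinear.Build k _ _ *:%R tswap tswap_linear.

Lemma tswapE u v : tswap (u *t v) = v *t u.
Proof. exact: tlift_pure. Qed.
End Swap.

Section Assoc.
Variables (U V W : lmodType k).

Let assoc2_bilinear (w : W) :
  bilinear_for *:%R *:%R (fun (u : U) (v : V) => u *t (v *t w)).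
Proof.
split=> [v|u]; first exact: tpure_linearl.
exact: (linear_compP (tpure_linearr _) (tpure_linearl _)).
Qed.

Definition tassoc : (U *T V) *T W -> U *T (V *T W) :=
  tlift (fun x w => tlift (fun u v => u *t (v *t w)) x).

Let tassoc_bilinear : bilinear_for *:%R *:%R
  (fun (x : U *T V) (w : W) => tlift (fun u v => u *t (v *t w)) x).
Proof.
split=> [w|x]; first exact: tlift_linear.
apply: tlift_linear_param => u v.
exact: (linear_compP (tpure_linearr _) (tpure_linearr _)).
Qed.

Lemma tassoc_linear : linear tassoc.
Proof. exact: tlift_linear tassoc_bilinear. Qed.
HB.instance Definition _ :=
  GRing.isLinear.Build k _ _ *:%R tassoc tassoc_linear.

Lemma tassocE u v w : tassoc ((u *t v) *t w) = u *t (v *t w).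
Proof. by rewrite /tassoc !tlift_pure. Qed.
End Assoc.

Section Middle.
Variables (U V U' V' : lmodType k).

Let f (u : U) (v : V) (u' : U') (v' : V') := (u *t u') *t (v *t v').

Let middle2_bilinear u v : bilinear_for *:%R *:%R (f u v).
Proof.
split=> [v'|u'].
  exact: (linear_compP (tpure_linearl _) (tpure_linearr _)).
exact: (linear_compP (tpure_linearr _) (tpure_linearr _)).
Qed.

Let middle1_bilinear (y : U' *T V') :
  bilinear_for *:%R *:%R (fun u v => tlift (f u v) y).
Proof.
split=> [v|u]; apply: tlift_linear_param => u' v'.
  exact: (linear_compP (tpure_linearl _) (tpure_linearl _)).
exact: (linear_compP (tpure_linearr _) (tpure_linearl _)).
Qed.

(* The exchange (u (x) v) (x) (u' (x) v') |-> (u (x) u') (x) (v (x) v'). *)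
Definition tmiddle : (U *T V) *T (U' *T V') -> (U *T U') *T (V *T V') :=
  tlift (fun x y => tlift (fun u v =>
    tlift (fun u' v' => (u *t u') *t (v *t v')) y) x).

Let tmiddle_bilinear : bilinear_for *:%R *:%R
  (fun x y => tlift (fun u v => tlift (f u v) y) x).
Proof.
split=> [y|x]; first exact: tlift_linear.
by apply: tlift_linear_param => u v; apply: tlift_linear.
Qed.

Lemma tmiddle_linear : linear tmiddle.
Proof. exact: tlift_linear tmiddle_bilinear. Qed.
HB.instance Definition _ :=
  GRing.isLinear.Build k _ _ *:%R tmiddle tmiddle_linear.

Lemma tmiddleE u v u' v' :
  tmiddle ((u *t v) *t (u' *t v')) = (u *t u') *t (v *t v').
Proof.
rewrite [LHS](tlift_pure tmiddle_bilinear) (tlift_pure (middle1_bilinear _)).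
exact: (tlift_pure (middle2_bilinear _ _)).
Qed.
End Middle.

(* (e (x) id) and (id (x) e), followed by k (x) V = V and U (x) k = U. *)
Section Contract.
Variables (U V : lmodType k).

Let contractl_bilinear (e : {linear U -> k^o}) :
  bilinear_for *:%R *:%R (fun (u : U) (v : V) => e u *: v).
Proof.
split=> [v|u] a x y; first by rewrite linearP scalerDl /= scalerA.
by rewrite scalerDr /= !scalerA mulrC.
Qed.

Definition contractl (e : U -> k^o) : U *T V -> V :=
  tlift (fun u v => e u *: v).

Lemma contractl_linear (e : {linear U -> k^o}) : linear (contractl e).
Proof. exact: tlift_linear (contractl_bilinear e). Qed.
HB.instance Definition _ (e : {linear U -> k^o}) :=
  GRing.isLinear.Build k _ _ *:%R (contractl e) (contractl_linear e).

Lemma contractlE (e : {linear U -> k^o}) u v : contractl e (u *t v) = e u *: v.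
Proof. exact: (tlift_pure (contractl_bilinear e)). Qed.

Let contractr_bilinear (e : {linear V -> k^o}) :
  bilinear_for *:%R *:%R (fun (u : U) (v : V) => e v *: u).
Proof.
split=> [v|u] a x y; last by rewrite linearP scalerDl /= scalerA.
by rewrite scalerDr /= !scalerA mulrC.
Qed.

Definition contractr (e : V -> k^o) : U *T V -> U :=
  tlift (fun u v => e v *: u).

Lemma contractr_linear (e : {linear V -> k^o}) : linear (contractr e).
Proof. exact: tlift_linear (contractr_bilinear e). Qed.
HB.instance Definition _ (e : {linear V -> k^o}) :=
  GRing.isLinear.Build k _ _ *:%R (contractr e) (contractr_linear e).

Lemma contractrE (e : {linear V -> k^o}) u v : contractr e (u *t v) = e v *: u.
Proof. exact: (tlift_pure (contractr_bilinear e)). Qed.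

End Contract.

End TensorMaps.
Arguments tswap {k U V}.
Arguments tassoc {k U V W}.
Arguments tmiddle {k U V U' V'}.

HB.mixin Record isCoalgebra (k : fieldType) C of GRing.Lmodule k C := {
  comul : {linear C -> C *T C};
  counit : {linear C -> k^o};
  comulA : forall c : C,
    tassoc (tmap comul idfun (comul c)) = tmap idfun comul (comul c);
  comul_counitl : forall c : C,
    contractl counit (comul c) = c;
  comul_counitr : forall c : C,
    contractr counit (comul c) = c
}.

#[short(type="coalgType")]
HB.structure Definition Coalgebra (k : fieldType) :=
  {C of isCoalgebra k C & GRing.Lmodule k C}.


Definition coop (C : Type) : Type := C.

HB.instance Definition _ (k : fieldType) (C : lmodType k) :=
  GRing.Lmodule.on (coop C).
Notation cop C := (Defs_coop__canonical__GRing_Lmodule C).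

Section CoopCoalgebra.
Context {k : fieldType} (C : coalgType k).

Definition cop_comul : cop C -> cop C *T cop C :=
  fun c => tswap (comul (c : C)).
Definition cop_counit : cop C -> k^o := counit : C -> k^o.

Lemma cop_comul_linear : linear cop_comul.
Proof. by move=> a x y; rewrite /cop_comul !linearP. Qed.
HB.instance Definition _ :=
  GRing.isLinear.Build k _ _ *:%R cop_comul cop_comul_linear.

Lemma cop_counit_linear : linear cop_counit.
Proof. exact: (@linearP _ _ _ _ (@counit k C)). Qed.
HB.instance Definition _ :=
  GRing.isLinear.Build k _ _ *:%R cop_counit cop_counit_linear.

Lemma cop_comulA (c : cop C) :
  tassoc (tmap cop_comul idfun (cop_comul c)) =
  tmap idfun cop_comul (cop_comul c).
Proof.
pose c' : C := c; rewrite /cop_comul -/c'.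
have E1 : tmap cop_comul idfun \o tswap =1
    tmap tswap idfun \o tswap \o tmap (idfun : C -> C) comul.
  by apply: tensor_ext => u v; do !rewrite /= !(tswapE, tmapE).
have E2 : tmap idfun cop_comul \o tswap =1
    tmap idfun tswap \o tswap \o tmap comul (idfun : C -> C).
  by apply: tensor_ext => u v; do !rewrite /= !(tswapE, tmapE).
have /= -> := E1 (comul c'); have /= -> := E2 (comul c').
rewrite -comulA.
have E3 : tassoc \o tmap tswap idfun \o tswap \o tassoc =1
    tmap idfun tswap \o (tswap : (C *T C) *T C -> _).
  apply: tensor_ext => x w; rewrite (tensorE x) linear_sumlz !linear_sum.
  by apply: eq_bigr => p _; do !rewrite /= !(tassocE, tswapE, tmapE).
exact: E3.
Qed.

Lemma cop_comul_counitl (c : cop C) :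
  contractl cop_counit (cop_comul c) = c.
Proof.
rewrite -[RHS](@comul_counitr _ C).
have E : contractl counit \o tswap =1
    (contractr counit : C *T C -> C).
  by apply: tensor_ext => u v; rewrite /= tswapE /= contractlE contractrE.
exact: E.
Qed.

Lemma cop_comul_counitr (c : cop C) :
  contractr cop_counit (cop_comul c) = c.
Proof.
rewrite -[RHS](@comul_counitl _ C).
have E : contractr counit \o tswap =1
    (contractl counit : C *T C -> C).
  by apply: tensor_ext => u v; rewrite /= tswapE /= contractlE contractrE.
exact: E.
Qed.

HB.instance Definition _ := isCoalgebra.Build k (coop C)
  cop_comulA cop_comul_counitl cop_comul_counitr.

Lemma comul_copE (c : C) : comul (c : cop C) = tswap (comul c).
Proof. by []. Qed.

Lemma counit_copE (c : C) : counit (c : cop C) = counit c.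
Proof. by []. Qed.

End CoopCoalgebra.

Section TensorCoalgebra.
Context {k : fieldType} (C D : coalgType k).

Definition tensor_comul : C *T D -> (C *T D) *T (C *T D) :=
  fun x => tmiddle (tmap comul comul x).
Definition tensor_counit : C *T D -> k^o :=
  tlift (fun c d => counit c * counit d : k^o).

Let tensor_counit_bilinear : bilinear_for *:%R *:%R
  (fun (c : C) (d : D) => counit c * counit d : k^o).
Proof.
split=> [d|c] a x y; rewrite linearP ?mulrDl ?mulrDr; congr (_ + _).
  exact/esym/mulrA.
exact: mulrCA.
Qed.

Lemma tensor_comul_linear : linear tensor_comul.
Proof. by move=> a x y; rewrite /tensor_comul !linearP. Qed.
HB.instance Definition _ :=
  GRing.isLinear.Build k _ _ *:%R tensor_comul tensor_comul_linear.

Lemma tensor_counit_linear : linear tensor_counit.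
Proof. exact: tlift_linear tensor_counit_bilinear. Qed.
HB.instance Definition _ :=
  GRing.isLinear.Build k _ _ *:%R tensor_counit tensor_counit_linear.

Lemma tensor_comulE c d :
  tensor_comul (c *t d) = tmiddle (comul c *t comul d).
Proof. by rewrite /tensor_comul tmapE. Qed.

Lemma tensor_counitE c d : tensor_counit (c *t d) = counit c * counit d.
Proof. exact: tlift_pure. Qed.

Lemma tensor_comulA x :
  tassoc (tmap tensor_comul idfun (tensor_comul x)) =
  tmap idfun tensor_comul (tensor_comul x).
Proof.
move: x; suff: tassoc \o tmap tensor_comul idfun \o tensor_comul =1
    tmap idfun tensor_comul \o tensor_comul by [].
apply: tensor_ext => c d /=; rewrite tensor_comulE.
have E1 : tmap tensor_comul idfun \o tmiddle =1 tmap tmiddle idfun \o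
    tmiddle \o tmap (tmap comul (idfun : C -> C)) (tmap comul (idfun : D -> D)).
  apply: tensor_ext2 => u v u' v'.
  by do !rewrite /= !(tmiddleE, tmapE, tensor_comulE).
have E2 : tmap idfun tensor_comul \o tmiddle =1 tmap idfun tmiddle \o
    tmiddle \o tmap (tmap (idfun : C -> C) comul) (tmap (idfun : D -> D) comul).
  apply: tensor_ext2 => u v u' v'.
  by do !rewrite /= !(tmiddleE, tmapE, tensor_comulE).
have /= -> := E1 (comul c *t comul d); have /= -> := E2 (comul c *t comul d).
rewrite !tmapE /= -!comulA.
move: (tmap _ _ (comul c)) (tmap _ _ (comul d)) => x y.
have E3 : tassoc \o tmap tmiddle idfun \o tmiddle =1
    tmap idfun tmiddle \o tmiddle \o tmap (@tassoc k C C C) (@tassoc k D D D).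
  apply: tensor_ext3 => u v w u' v' w'.
  by do !rewrite /= !(tmiddleE, tmapE, tassocE).
by have /= := E3 (x *t y); rewrite tmapE.
Qed.

Lemma tensor_comul_counitl x :
  contractl tensor_counit (tensor_comul x) = x.
Proof.
move: x; suff: contractl tensor_counit \o tensor_comul =1 idfun by [].
apply: tensor_ext => c d; rewrite /= tensor_comulE.
have E : contractl tensor_counit \o tmiddle =1
    tmap (contractl counit : C *T C -> C) (contractl counit : D *T D -> D).
  apply: tensor_ext2 => u v u' v' /=.
  rewrite tmiddleE tmapE /= !contractlE /= tensor_counitE.
  by rewrite linearZr_LR linearZl_LR /= scalerA mulrC.
by have /= -> := E (comul c *t comul d); rewrite tmapE /= !comul_counitl.
Qed.

Lemma tensor_comul_counitr x :
  contractr tensor_counit (tensor_comul x) = x.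
Proof.
move: x; suff: contractr tensor_counit \o tensor_comul =1 idfun by [].
apply: tensor_ext => c d; rewrite /= tensor_comulE.
have E : contractr tensor_counit \o tmiddle =1
    tmap (contractr counit : C *T C -> C) (contractr counit : D *T D -> D).
  apply: tensor_ext2 => u v u' v' /=.
  rewrite tmiddleE tmapE /= !contractrE /= tensor_counitE.
  by rewrite linearZr_LR linearZl_LR /= scalerA mulrC.
by have /= -> := E (comul c *t comul d); rewrite tmapE /= !comul_counitr.
Qed.

HB.instance Definition _ := isCoalgebra.Build k (tensor C D)
  tensor_comulA tensor_comul_counitl tensor_comul_counitr.

Lemma comul_tensorE (c : C) (d : D) :
  comul (c *t d) = tmiddle (comul c *t comul d).
Proof. exact: tensor_comulE. Qed.

Lemma counit_tensorE (c : C) (d : D) :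
  counit (c *t d) = counit c * counit d :> k.
Proof. exact: tensor_counitE. Qed.

End TensorCoalgebra.

Section Coalgebras.
Context {k : fieldType}.

Definition coalg_map (C D : coalgType k) (f : {linear C -> D}) : Prop :=
  (forall c, comul (f c) = tmap f f (comul c)) /\
  (forall c, counit (f c) = counit c).

Definition grouplike (C : coalgType k) (x : C) : Prop :=
  comul x = x *t x /\ counit x = 1.

(* Sweedler notation: sweedler2 c (fun c1 c2 => E) and
   sweedler3 c (fun c1 c2 c3 => E) are the sums of the values of E over
   Delta(c) = c1 (x) c2 and (Delta (x) id)(Delta(c)) = c1 (x) c2 (x) c3; as in
   informal usage, E must be multilinear in the ci. *)
Definition sweedler2 (C : coalgType k) (W : lmodType k) (c : C)
    (f : C -> C -> W) : W := tlift f (comul c).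

Definition sweedler3 (C : coalgType k) (W : lmodType k) (c : C)
    (f : C -> C -> C -> W) : W :=
  sweedler2 c (fun c' c3 => sweedler2 c' (fun c1 c2 => f c1 c2 c3)).

End Coalgebras.

Section HopfStructures.
Context {k : fieldType} (H : coalgType k).

Section HeapBracket.
Variable chi : {linear (H *T cop H) *T H -> H}.

Definition heap (a b c : H) : H := chi ((a *t (b : cop H)) *t c).

Record is_hopf_heap : Prop := IsHopfHeap {
  heap_coalg_map : coalg_map chi;
  heapA : forall a b c d h, heap (heap a b c) d h = heap a b (heap c d h);
  heap_counitl : forall c a,
    sweedler2 c (fun c1 c2 => heap c1 c2 a) = (counit c : k) *: a;
  heap_counitr : forall c a,
    sweedler2 c (fun c1 c2 => heap a c1 c2) = (counit c : k) *: a
}.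

Variable x : H.

Let heap_mul_bilinear : bilinear_for *:%R *:%R (fun a b : H => heap a x b).
Proof.
split=> [b|a] l c d; rewrite /heap; last by rewrite tpure_linearr linearP.
by rewrite !tpure_linearl linearP.
Qed.

(* The product ab = [a, x, b] and the antipode S(a) = [x, a, x]. *)
Definition heap_mul_fun : H *T H -> H := tlift (fun a b => heap a x b).

Definition heap_antipode_fun (a : H) : H := heap x a x.

Lemma heap_mul_linear : linear heap_mul_fun.
Proof. exact: tlift_linear heap_mul_bilinear. Qed.
HB.instance Definition _ :=
  GRing.isLinear.Build k _ _ *:%R heap_mul_fun heap_mul_linear.

Lemma heap_antipode_linear : linear heap_antipode_fun.
Proof.
move=> l a b; rewrite /heap_antipode_fun /heap.
by rewrite (tpure_linearr (V := cop H)) tpure_linearl linearP.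
Qed.
HB.instance Definition _ :=
  GRing.isLinear.Build k _ _ *:%R heap_antipode_fun heap_antipode_linear.

Definition heap_mul : {linear H *T H -> H} := heap_mul_fun.
Definition heap_antipode : {linear H -> H} := heap_antipode_fun.

Lemma heap_mulE a b : heap_mul (a *t b) = heap a x b.
Proof. exact: (tlift_pure heap_mul_bilinear). Qed.

Lemma heap_antipodeE a : heap_antipode a = heap x a x.
Proof. by []. Qed.

End HeapBracket.

Record is_nonunital_bialgebra (circ : {linear H *T H -> H}) : Prop :=
  IsNonunitalBialgebra {
    circ_coalg_map : coalg_map circ;
    circA : forall a b c, circ (a *t circ (b *t c)) = circ (circ (a *t b) *t c)
  }.

Record is_hopf_algebra (mul : {linear H *T H -> H}) (one : H)
    (S : {linear H -> H}) : Prop := IsHopfAlgebra {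
  hopf_mulA : forall a b c, mul (a *t mul (b *t c)) = mul (mul (a *t b) *t c);
  hopf_mul1 : forall a, mul (one *t a) = a;
  hopf_mulr1 : forall a, mul (a *t one) = a;
  hopf_mul_coalg_map : coalg_map mul;
  (* the unit map k -> H is a coalgebra map *)
  hopf_one_grouplike : grouplike one;
  hopf_antipodel : forall a,
    sweedler2 a (fun a1 a2 => mul (S a1 *t a2)) = (counit a : k) *: one;
  hopf_antipoder : forall a,
    sweedler2 a (fun a1 a2 => mul (a1 *t S a2)) = (counit a : k) *: one
}.

Record is_hopf_truss (mul : {linear H *T H -> H}) (one : H)
    (S : {linear H -> H}) (circ : {linear H *T H -> H}) : Prop := IsHopfTruss {
  truss_hopf_algebra : is_hopf_algebra mul one S;
  truss_nonunital_bialgebra : is_nonunital_bialgebra circ;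
  truss_distr : exists sigma : {linear H -> H},
    coalg_map sigma /\
    forall a b c : H, circ (a *t mul (b *t c)) =
      sweedler3 a (fun a1 a2 a3 =>
        mul (mul (circ (a1 *t b) *t S (sigma a2)) *t circ (a3 *t c)))
}.

End HopfStructures.

(* Main.v *)
(** Work in the algebra of linear maps from H to H under convolution f * g,
    where the antipode S inverts coalgebra maps. Write f_b for the map
    a |-> a o b and s for sigma. Since [b, c, d] = b S(c) d, the bracket
    identity reads f_[b,c,d] = f_b * S f_c * f_d, while the truss axiom reads
    f_(bc) = f_b * S s * f_c. The bracket identity at c = x is the truss axiom
    with s = f_x. Conversely, the truss axiom at b = c = x forces s = f_x, and
    applied to S(c_1) c_2 = eps(c) x it gives f_(S c) = s * S f_c * s, so that
    f_[b,c,d] = f_b * S s * (s * S f_c * s) * S s * f_d = f_b * S f_c * f_d. *)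
Require Import Defs.
From HB Require Import structures.
From mathcomp Require Import all_boot all_algebra.
From mathcomp Require Import boolp.

Set Implicit Arguments.
Unset Strict Implicit.
Unset Printing Implicit Defensive.

Import GRing.Theory.
Local Open Scope ring_scope.

(** * Linear maps on tensor products *)

Section TensorMapsTheory.
Context {k : fieldType}.

Lemma tmap_comp (U U' U'' V V' V'' : lmodType k)
    (f : {linear U' -> U''}) (f' : {linear U -> U'})
    (g : {linear V' -> V''}) (g' : {linear V -> V'}) t :
  tmap f g (tmap f' g' t) = tmap (f \o f') (g \o g') t.
Proof.
by move: t; apply: (@tensor_ext _ _ _ _ (tmap f g \o tmap f' g')) => u v;
  rewrite /= !tmapE.
Qed.

(** Bundled so that [circ \o tensl b] is the linear map f_b. *)
Definition tensl (U V : lmodType k) (v : V) (u : U) : U *T V := u *t v.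
HB.instance Definition _ (U V : lmodType k) (v : V) :=
  GRing.isLinear.Build k U (U *T V) *:%R (tensl v) (tpure_linearl v).

(** Precomposition with it extends a map on [C] to [C *T D], constant in the second variable up to
    the counit. *)
Definition counitr (C D : coalgType k) : C *T D -> C := contractr counit.
HB.instance Definition _ (C D : coalgType k) :=
  GRing.Linear.on (@counitr C D).

Lemma counitrE (C D : coalgType k) (c : C) (d : D) :
  counitr (c *t d) = (counit d : k) *: c.
Proof. exact: contractrE. Qed.

Lemma sweedler2_tensor (C D : coalgType k) (W : lmodType k)
    (B : {linear (C *T D) *T (C *T D) -> W}) (c : C) (d : D) :
  B (comul (c *t d)) = sweedler2 d (fun d1 d2 =>
    sweedler2 c (fun c1 c2 => B ((c1 *t d1) *t (c2 *t d2)))).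
Proof.
rewrite comul_tensorE {1}(tensorE (comul c)) {1}(tensorE (comul d)).
rewrite linear_sumr (linear_sum tmiddle) (linear_sum B); apply: eq_bigr => q _.
rewrite linear_sumlz (linear_sum tmiddle) (linear_sum B); apply: eq_bigr => p _.
by rewrite /= tmiddleE.
Qed.

End TensorMapsTheory.

(** * The convolution product and its unit *)

Section Convolution.
Context {k : fieldType} (C H : coalgType k) (mul : {linear H *T H -> H}).

Definition conv (f g : C -> H) : C -> H := mul \o tmap f g \o comul.
HB.instance Definition _ (f g : {linear C -> H}) :=
  GRing.Linear.copy (conv f g) (mul \o tmap f g \o comul).

Definition conv_unit (one : H) (c : C) : H := (counit c : k) *: one.

Lemma conv_unit_linear one : linear (conv_unit one).
Proof. by move=> a x y; rewrite /conv_unit linearP scalerDl scalerA. Qed.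
HB.instance Definition _ one :=
  GRing.isLinear.Build k C H *:%R (conv_unit one) (conv_unit_linear one).

Lemma convE f g c :
  conv f g c = sweedler2 c (fun c1 c2 => mul (f c1 *t g c2)).
Proof. by rewrite /conv /= /tmap /sweedler2 /tlift linear_sum. Qed.

Lemma conv3E f g (h : {linear C -> H}) c :
  conv (conv f g) h c =
  sweedler3 c (fun c1 c2 c3 => mul (mul (f c1 *t g c2) *t h c3)).
Proof.
rewrite convE /sweedler3 /sweedler2 /tlift; apply: eq_bigr => p _.
by rewrite convE /sweedler2 /tlift linear_sumlz linear_sum.
Qed.

Variables (one : H) (S : {linear H -> H}).
Hypothesis Hopf : is_hopf_algebra mul one S.
Implicit Types f g h : {linear C -> H}.

Lemma convA f g h : conv f (conv g h) = conv (conv f g) h.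
Proof.
apply/funext => c; rewrite /conv /=.
have -> t : tmap (mul \o tmap f g \o comul) h t =
    tmap (mul \o tmap f g) h (tmap comul idfun t).
  by rewrite tmap_comp.
have -> t : tmap f (mul \o tmap g h \o comul) t =
    tmap f (mul \o tmap g h) (tmap idfun comul t).
  by rewrite tmap_comp.
(* Coassociativity brings both sides to the same threefold coproduct; what remains is associativity
   of [mul] on pure tensors. *)
rewrite -comulA; move: (tmap comul _ _) => t.
suff E : mul \o tmap f (mul \o tmap g h) \o tassoc =1
    mul \o tmap (mul \o tmap f g) h by apply: E.
apply: tensor_ext => x w; rewrite (tensorE x) linear_sumlz !linear_sum.
apply: eq_bigr => p _; rewrite /= tassocE !tmapE /= !tmapE.
exact: (hopf_mulA Hopf).
Qed.

Lemma conv1l f : conv (conv_unit one) f = f.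
Proof.
apply/funext => c; rewrite -[in RHS](comul_counitl c) convE.
rewrite /sweedler2 /contractl /tlift linear_sum; apply: eq_bigr => p _ /=.
by rewrite linearZl_LR linearZ /= (hopf_mul1 Hopf) linearZ.
Qed.

Lemma conv1r f : conv f (conv_unit one) = f.
Proof.
apply/funext => c; rewrite -[in RHS](comul_counitr c) convE.
rewrite /sweedler2 /contractr /tlift linear_sum; apply: eq_bigr => p _ /=.
by rewrite linearZr_LR linearZ /= (hopf_mulr1 Hopf) linearZ.
Qed.

End Convolution.

(** * Convolution inverses of coalgebra maps *)

Section ConvolutionAntipode.
Context {k : fieldType} (C H : coalgType k) (mul : {linear H *T H -> H}).
Variables (one : H) (S : {linear H -> H}).
Hypothesis Hopf : is_hopf_algebra mul one S.
Variable f : {linear C -> H}.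
Hypothesis fC : coalg_map f.

(** As [f] commutes with the coproducts, the left side is the convolution of [S] and the identity,
    precomposed with [f]. *)
Lemma conv_antipodel : conv mul (S \o f) f = conv_unit one.
Proof.
case: fC => fD fe; apply/funext => c; rewrite /conv_unit -fe.
rewrite -(hopf_antipodel Hopf).
by rewrite -[RHS](convE mul S idfun) /conv /= fD tmap_comp.
Qed.

Lemma conv_antipoder : conv mul f (S \o f) = conv_unit one.
Proof.
case: fC => fD fe; apply/funext => c; rewrite /conv_unit -fe.
rewrite -(hopf_antipoder Hopf).
by rewrite -[RHS](convE mul idfun S) /conv /= fD tmap_comp.
Qed.

End ConvolutionAntipode.

(** * Convolution on a tensor product of coalgebras *)

Section ConvolutionTensor.
Context {k : fieldType} (C D H : coalgType k) (mul : {linear H *T H -> H}).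
Implicit Types (U V : {linear C *T D -> H}) (u : {linear C -> H}).

Lemma conv_tensor U V c d : conv mul U V (c *t d) =
  sweedler2 d (fun d1 d2 => conv mul (U \o tensl d1) (V \o tensl d2) c).
Proof.
rewrite [LHS](sweedler2_tensor (mul \o tmap U V)).
apply: eq_bigr => q _; rewrite convE.
by apply: eq_bigr => p _; rewrite /= tmapE.
Qed.

(** The counit absorbs one Sweedler factor of [d], so only [c] is still split. *)
Lemma conv_counitr U u c d :
  conv mul U (u \o @counitr _ C D) (c *t d) = conv mul (U \o tensl d) u c.
Proof.
rewrite conv_tensor convE -[d in RHS]comul_counitr.
rewrite /sweedler2 /contractr /tlift.
under eq_bigr do rewrite convE /sweedler2 /tlift.
rewrite exchange_big; apply: eq_bigr => p _; rewrite /= /tensl linear_sumr linear_sum linear_sumlz linear_sum.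
apply: eq_bigr => q _ /=; rewrite /tensl counitrE.
by rewrite linearZ linearZr_LR [in RHS]linearZr_LR [in RHS]linearZ linearZl_LR.
Qed.

Lemma conv_counitl U u c d :
  conv mul (u \o @counitr _ C D) U (c *t d) = conv mul u (U \o tensl d) c.
Proof.
rewrite conv_tensor convE -[d in RHS]comul_counitl.
rewrite /sweedler2 /contractl /tlift.
under eq_bigr do rewrite convE /sweedler2 /tlift.
rewrite exchange_big; apply: eq_bigr => p _; rewrite /= /tensl linear_sumr linear_sum linear_sumr linear_sum.
apply: eq_bigr => q _ /=; rewrite /tensl counitrE.
by rewrite linearZ linearZl_LR [in RHS]linearZr_LR [in RHS]linearZ linearZr_LR.
Qed.

End ConvolutionTensor.

(** * The Hopf algebra of a Hopf heap at a grouplike element *)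

Section HeapHopf.
Context {k : fieldType} (H : coalgType k).
Variables (chi : {linear (H *T cop H) *T H -> H}) (x : H).
Hypotheses (heapH : is_hopf_heap chi) (xG : grouplike x).
Local Notation mul := (heap_mul chi x).
Local Notation S := (heap_antipode chi x).

Lemma heap_grouplikel a : heap chi x x a = a.
Proof.
have := heap_counitl heapH x a; rewrite /sweedler2 xG.1 xG.2 scale1r.
rewrite tlift_pure //; split=> [v|u] l c d; rewrite /heap.
  by rewrite !tpure_linearl linearP.
by rewrite (tpure_linearr (V := cop H)) tpure_linearl linearP.
Qed.

Lemma heap_groupliker a : heap chi a x x = a.
Proof.
have := heap_counitr heapH x a; rewrite /sweedler2 xG.1 xG.2 scale1r.
rewrite tlift_pure //; split=> [v|u] l c d; rewrite /heap.
  by rewrite (tpure_linearr (V := cop H)) tpure_linearl linearP.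
by rewrite tpure_linearr linearP.
Qed.

Lemma heap_mul_antipode a b c : mul (mul (a *t S b) *t c) = heap chi a b c.
Proof.
rewrite !heap_mulE heap_antipodeE -(heapA heapH a) heap_groupliker.
by rewrite (heapA heapH) heap_grouplikel.
Qed.

Lemma heap_mul_coalg_map : coalg_map mul.
Proof.
have [chiD chie] := heap_coalg_map heapH.
split.
  suff: comul \o mul =1 tmap mul mul \o comul by [].
  apply: tensor_ext => a b /=; rewrite heap_mulE /heap chiD.
  rewrite !comul_tensorE comul_copE xG.1 tswapE.
  (* [ins] sends [a1 *t a2] to [(a1 *t x) *t (a2 *t x)]; the coproducts of [a] and [b] thus become
     free variables, and pure tensors suffice. *)
  pose ins := tmiddle \o tensl (U := H *T H) ((x : cop H) *t (x : cop H)).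
  suff E : tmap chi chi \o tmiddle \o tmap ins idfun =1 tmap mul mul \o tmiddle.
    by have := E (comul a *t comul b); rewrite [X in X = _]/= tmapE.
  apply: tensor_ext2 => u v u' v'.
  rewrite [LHS]/= tmapE /= /tensl !tmiddleE !tmapE.
  by congr (_ *t _); apply/esym/heap_mulE.
suff: counit \o mul =1 counit by [].
apply: tensor_ext => a b /=; rewrite heap_mulE /heap chie !counit_tensorE.
by rewrite counit_copE xG.2 mulr1.
Qed.

(** The antipode laws are the heap counit laws: S(a_1) a_2 = [[x, a_1, x], x, a_2] = [x, a_1, a_2],
    and symmetrically. *)
Lemma heap_hopf_algebra : is_hopf_algebra mul x S.
Proof.
split=> //.
- by move=> a b c; rewrite !heap_mulE (heapA heapH).
- by move=> a; rewrite heap_mulE heap_grouplikel.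
- by move=> a; rewrite heap_mulE heap_groupliker.
- exact: heap_mul_coalg_map.
- move=> a; rewrite -(heap_counitr heapH a x); apply: eq_bigr => p _.
  by rewrite heap_mulE heap_antipodeE (heapA heapH) heap_grouplikel.
move=> a; rewrite -(heap_counitl heapH a x); apply: eq_bigr => p _.
by rewrite heap_mulE heap_antipodeE -(heapA heapH) heap_groupliker.
Qed.

End HeapHopf.

(** * From the truss axiom to the bracket identity *)

Section Truss.
Context {k : fieldType} (H : coalgType k).
Variables (mul circ : {linear H *T H -> H}) (one : H).
Variables S sigma : {linear H -> H}.
Hypothesis Hopf : is_hopf_algebra mul one S.
Hypothesis circC : coalg_map circ.
Hypothesis sigmaC : coalg_map sigma.

(** Makes f_x convolution invertible, and admissible as a choice of [sigma]. *)
Lemma coalg_map_circ_grouplike x :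
  grouplike x -> coalg_map (circ \o tensl x).
Proof.
case: circC => cD ce [xD xe]; split=> [a|a] /=; last first.
  by rewrite ce counit_tensorE xe mulr1.
rewrite cD comul_tensorE xD.
suff E : tmap circ circ \o tmiddle \o tensl (x *t x) =1
    tmap (circ \o tensl x) (circ \o tensl x) by apply: E.
apply: tensor_ext => u v; rewrite [LHS]/= /tensl tmiddleE tmapE.
exact/esym/tmapE.
Qed.

Hypothesis distr : forall b c, circ \o tensl (mul (b *t c)) =
  conv mul (conv mul (circ \o tensl b) (S \o sigma)) (circ \o tensl c).

(** At b = c = 1 the axiom reads tau = tau * S sigma * tau. Cancelling the invertible tau on the
    left gives S sigma * tau = 1, and S sigma is also inverse to [sigma]. *)
Lemma truss_sigmaE : sigma = circ \o tensl one :> (H -> H).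
Proof.
pose tau : {linear H -> H} := circ \o tensl one.
have Stau : conv mul (S \o tau) tau = conv_unit one.
  by apply: (conv_antipodel Hopf); apply: coalg_map_circ_grouplike;
    apply: (hopf_one_grouplike Hopf).
have tauE : tau = conv mul tau (conv mul (S \o sigma) tau) :> (H -> H).
  by rewrite (convA Hopf) -distr (hopf_mul1 Hopf).
have sigma_tau : conv mul (S \o sigma) tau = conv_unit one.
  by rewrite -[LHS](conv1l Hopf) -Stau -(convA Hopf) -tauE.
rewrite -[LHS](conv1r Hopf) -sigma_tau (convA Hopf).
by rewrite (conv_antipoder Hopf) // (conv1l Hopf).
Qed.

(* The identity for [f_(S c)] is proved for all [c] at once, by convolving maps
   [H *T H -> H] in the variables [a *t c]; there [circ] is a coalgebra map,
   hence has the convolution inverse [S \o circ]. *)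
Let T := sigma \o @counitr _ H H.
Let ST := (S \o sigma) \o @counitr _ H H.
Let G := circ \o tmap idfun S.

Let G_tensl c : G \o tensl c = circ \o tensl (S c).
Proof. by apply/funext => a; rewrite /G /= /tensl tmapE. Qed.

(** At [a *t c] the left side is the truss axiom for the product S(c_1) c_2, hence eps(c) (a o 1) =
    eps(c) sigma(a). *)
Let conv_G_ST_circ : conv mul (conv mul G ST) circ = T.
Proof.
apply/funext/tensor_ext => a c.
rewrite -[LHS]/(conv mul (conv mul G ST) circ (a *t c)) conv_tensor.
have E c1 : conv mul G ST \o tensl c1 =
    conv mul (circ \o tensl (S c1)) (S \o sigma).
  by apply/funext => a1; rewrite -G_tensl -conv_counitr.
transitivity (circ (a *t ((counit c : k) *: one))).
  rewrite -(hopf_antipodel Hopf) /sweedler2 /tlift linear_sumr linear_sum.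
  by apply: eq_bigr => p _; rewrite E -distr.
by rewrite linearZr_LR linearZ /T /= counitrE linearZ truss_sigmaE.
Qed.

Let conv_ST_T : conv mul ST T = conv_unit one.
Proof.
apply/funext/tensor_ext => a c.
rewrite -[LHS]/(conv mul ST T (a *t c)) conv_counitr.
transitivity ((counit c : k) *: conv mul (S \o sigma) sigma a).
  rewrite !convE /sweedler2 /tlift scaler_sumr; apply: eq_bigr => p _.
  by rewrite /= /tensl counitrE !linearZ linearZl_LR linearZ.
rewrite (conv_antipodel Hopf) // -[RHS]/((counit (a *t c) : k) *: one).
by rewrite counit_tensorE scalerA mulrC.
Qed.

(** Solve [conv_G_ST_circ] for [G]: cancel [circ] on the right by [S \o circ], then [ST] by [T].
    Fixing [c] gives the claim. *)
Lemma truss_circ_antipode c : circ \o tensl (S c) =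
  conv mul (conv mul sigma (S \o (circ \o tensl c))) sigma.
Proof.
have GE : G = conv mul (conv mul T (S \o circ)) T.
  rewrite -{1}conv_G_ST_circ -(convA Hopf _ circ) (conv_antipoder Hopf) //.
  by rewrite (conv1r Hopf) -(convA Hopf) conv_ST_T (conv1r Hopf).
rewrite -G_tensl GE; apply/funext => a; rewrite /= conv_counitr.
congr (conv _ _ _ _); apply/funext => a1; exact: conv_counitl.
Qed.

Lemma truss_circ_heap b c d : circ \o tensl (mul (mul (b *t S c) *t d)) =
  conv mul (conv mul (circ \o tensl b) (S \o (circ \o tensl c)))
    (circ \o tensl d).
Proof.
rewrite !distr truss_circ_antipode; do !rewrite -(convA Hopf) /=.
rewrite (convA Hopf sigma (S \o sigma)) (conv_antipoder Hopf) //.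
rewrite (conv1l Hopf) (convA Hopf (S \o sigma) sigma).
by rewrite (conv_antipodel Hopf) // (conv1l Hopf).
Qed.

End Truss.

(* By the passage between Hopf heaps and Hopf algebras, H carries one Hopf
   algebra structure for each grouplike x; the equivalence holds for each. *)
Theorem proposition3p3 (k : fieldType) (H : coalgType k)
    (chi : {linear (H *T cop H) *T H -> H}) (circ : {linear H *T H -> H})
    (x : H) :
  is_hopf_heap chi -> is_nonunital_bialgebra circ -> grouplike x ->
  is_hopf_truss (heap_mul chi x) x (heap_antipode chi x) circ <->
  (forall a b c d : H,
     circ (a *t heap chi b c d) =
     sweedler3 a (fun a1 a2 a3 =>
       heap chi (circ (a1 *t b)) (circ (a2 *t c)) (circ (a3 *t d)))).
Proof.
move=> heapH circB xG; have Hopf := heap_hopf_algebra heapH xG.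
have circC := circ_coalg_map circB.
split=> [[_ _ [sigma [sigmaC distr]]] a b c d | distr].
  have distrC b' c' : circ \o tensl (heap_mul chi x (b' *t c')) =
      conv (heap_mul chi x) (conv (heap_mul chi x) (circ \o tensl b')
        (heap_antipode chi x \o sigma)) (circ \o tensl c').
    by apply/funext => a'; rewrite conv3E -[RHS]distr.
  rewrite -(heap_mul_antipode heapH xG).
  have /(congr1 (@^~ a)) := truss_circ_heap Hopf circC sigmaC distrC b c d.
  rewrite conv3E /= => ->; apply: eq_bigr => p _; apply: eq_bigr => q _.
  exact: heap_mul_antipode.
split=> //; exists (circ \o tensl x); split.
  exact: coalg_map_circ_grouplike.
move=> a b c; rewrite heap_mulE distr.
apply: eq_bigr => p _; apply: eq_bigr => q _.
by rewrite (heap_mul_antipode heapH xG).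
Qed.
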